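(* Let $F$ be a field and let $f\colon A\to B$, where $A=\bigoplus_{g\in G}A^{(g)}$, be a morphism in $\widetilde{\mathbf{GrAlg}_F}$ (respectively, in $\widetilde{\mathbf{GrAlg}^1_F}$). Then $f$ is a monomorphism in that category if and only if for all $a,b\in\bigcup_{g\in G}A^{(g)}$ with $a\neq b$ one has $f(a)\neq f(b)$.
   Context: Algebras are associative over the field $F$, not necessarily unital or commutative. A grading on an algebra $A$ by a group $G$ is a decomposition $A=\bigoplus_{g\in G}A^{(g)}$ into a direct sum of subspaces with $A^{(g)}A^{(h)}\subseteq A^{(gh)}$ for all $g,h\in G$. A homomorphism of algebras $\psi\colon A\to B$ between algebras graded by groups $G$ and $H$ (possibly different) is graded if for every $g\in G$ there exists $h\in H$ with $\psi(A^{(g)})\subseteq B^{(h)}$. A graded homomorphism is graded injective if its restriction to each homogeneous component $A^{(g)}$ is injective. $\widetilde{\mathbf{GrAlg}_F}$ is the category whose objects are all gradings by arbitrary groups on (not necessarily unital) associative $F$-algebras and whose morphisms are the graded injective homomorphisms. $\widetilde{\mathbf{GrAlg}^1_F}$ is the category whose objects are all group gradings on unital associative $F$-algebras and whose morphisms are the unital graded injective homomorphisms. *)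

(* Defs.v *)
From HB Require Import structures.
From mathcomp Require Import all_boot all_order all_algebra.
From mathcomp Require Import boolp classical_sets.

Set Implicit Arguments.
Unset Strict Implicit.
Unset Printing Implicit Defensive.

Import GRing.Theory.
Local Open Scope ring_scope.
Local Open Scope classical_set_scope.

Record category := Category {
  cat_obj :> Type;
  cat_hom : cat_obj -> cat_obj -> Type;
  cat_id : forall a, cat_hom a a;
  cat_comp : forall a b c, cat_hom b c -> cat_hom a b -> cat_hom a c;
  cat_compIl : forall a b (f : cat_hom a b), cat_comp (cat_id b) f = f;
  cat_compIr : forall a b (f : cat_hom a b), cat_comp f (cat_id a) = f;
  cat_compA : forall a b c d
    (h : cat_hom c d) (g : cat_hom b c) (f : cat_hom a b),
    cat_comp h (cat_comp g f) = cat_comp (cat_comp h g) f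
}.

Definition monomorphism (C : category) (a b : C) (f : cat_hom a b) : Prop :=
  forall (z : C) (u v : cat_hom z a), cat_comp f u = cat_comp f v -> u = v.
Arguments monomorphism C {a b} f.

(* The product of an algebra is the one of [semigroupType], written [*%g],
   because the rings and algebras of ssralg all have a unit, and their
   algebras are moreover nonzero. *)
HB.mixin Record isBilinearMul (F : fieldType) A
    of GRing.Lmodule F A & Semigroup A := {
  amulDl : forall x y z : A, ((x + y) * z)%g = (x * z)%g + (y * z)%g;
  amulDr : forall x y z : A, (x * (y + z))%g = (x * y)%g + (x * z)%g;
  amulZl : forall (c : F) (x y : A), ((c *: x) * y)%g = c *: (x * y)%g;
  amulZr : forall (c : F) (x y : A), (x * (c *: y))%g = c *: (x * y)%g
}.

#[short(type="assocAlgType")]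
HB.structure Definition AssocAlgebra (F : fieldType) :=
  {A of GRing.Lmodule F A & Semigroup A & isBilinearMul F A}.

(* [0 = 1%g] is allowed: the zero algebra is unital. *)
#[short(type="unitalAlgType")]
HB.structure Definition UnitalAlgebra (F : fieldType) :=
  {A of GRing.Lmodule F A & Monoid A & isBilinearMul F A}.

Section Gradings.
Variables (F : fieldType).

(* [grading_span] and [grading_indep] say that [A] is the direct sum of the
   [C g], for a group [G] that may be infinite. *)
Record is_grading (A : assocAlgType F) (G : groupType) (C : G -> set A) :
    Prop := IsGrading {
  grading0 : forall g, C g 0;
  gradingP : forall g (c : F) x y, C g x -> C g y -> C g (c *: x + y);
  grading_span : forall x, exists (s : seq G) (u : G -> A),
    [/\ uniq s, forall g, C g (u g) & x = \sum_(g <- s) u g];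
  grading_indep : forall (s : seq G) (u : G -> A),
    uniq s -> (forall g, C g (u g)) -> \sum_(g <- s) u g = 0 ->
    forall g, g \in s -> u g = 0;
  grading_mul : forall g h x y, C g x -> C h y -> C (g * h)%g (x * y)%g
}.

Definition alg_hom (A B : assocAlgType F) (f : A -> B) : Prop :=
  linear f /\ {morph f : x y / (x * y)%g}.

Definition graded (A B : assocAlgType F) (G H : groupType)
    (C : G -> set A) (D : H -> set B) (f : A -> B) : Prop :=
  forall g, exists h, f @` C g `<=` D h.

Definition graded_injective (A B : assocAlgType F) (G : groupType)
    (C : G -> set A) (f : A -> B) : Prop :=
  forall g x y, C g x -> C g y -> f x = f y -> x = y.

Definition homogeneous (A : assocAlgType F) (G : groupType)
  (C : G -> set A) : set A := \bigcup_g C g.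

Lemma alg_hom_id (A : assocAlgType F) : alg_hom (@id A).
Proof. by []. Qed.

Lemma alg_hom_comp (A B C : assocAlgType F) (f : B -> C) (g : A -> B) :
  alg_hom f -> alg_hom g -> alg_hom (f \o g).
Proof.
move=> [fl fm] [gl gm]; split; first by move=> c x y /=; rewrite gl fl.
by move=> x y /=; rewrite gm fm.
Qed.

Lemma graded_id (A : assocAlgType F) (G : groupType) (C : G -> set A) :
  graded C C id.
Proof. by move=> g; exists g => _ [x Cx <-]. Qed.

Lemma graded_comp (A B E : assocAlgType F) (G H K : groupType)
    (P : G -> set A) (Q : H -> set B) (R : K -> set E)
    (f : B -> E) (g : A -> B) :
  graded Q R f -> graded P Q g -> graded P R (f \o g).
Proof.
move=> fg gg i; have [j Pj] := gg i; have [k Qk] := fg j.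
by exists k => _ [x Px <-]; apply: Qk; exists (g x) => //; apply: Pj; exists x.
Qed.

Lemma graded_injective_id (A : assocAlgType F) (G : groupType)
    (C : G -> set A) : graded_injective C (@id A).
Proof. by []. Qed.

Lemma graded_injective_comp (A B E : assocAlgType F) (G H : groupType)
    (P : G -> set A) (Q : H -> set B) (f : B -> E) (g : A -> B) :
  graded_injective Q f -> graded P Q g -> graded_injective P g ->
  graded_injective P (f \o g).
Proof.
move=> fi gg gi i x y Px Py /= fxy; have [j Pj] := gg i.
by apply: (gi i) => //; apply: (fi j) fxy; apply: Pj; [exists x | exists y].
Qed.

Record gralg := GrAlgObj {
  gralg_sort :> assocAlgType F;
  gralg_group : groupType;
  gralg_part : gralg_group -> set gralg_sort;
  gralg_grading : is_grading gralg_part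
}.
Arguments gralg_part : clear implicits.

Record gralg_hom (A B : gralg) := GrAlgHom {
  gralg_fun :> A -> B;
  gralg_alg_hom : alg_hom gralg_fun;
  gralg_graded : graded (gralg_part A) (gralg_part B) gralg_fun;
  gralg_inj : graded_injective (gralg_part A) gralg_fun
}.

Lemma gralg_hom_ext (A B : gralg) (f g : gralg_hom A B) :
  gralg_fun f = gralg_fun g -> f = g.
Proof.
case: f g => [f f1 f2 f3] [g g1 g2 g3] /= fg.
by case: g / fg g1 g2 g3 => g1 g2 g3; congr GrAlgHom; apply: Prop_irrelevance.
Qed.

Definition gralg_idmap (A : gralg) : gralg_hom A A :=
  GrAlgHom (alg_hom_id A) (@graded_id _ _ _) (@graded_injective_id _ _ _).

Definition gralg_comp (A B C : gralg) (f : gralg_hom B C)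
    (g : gralg_hom A B) : gralg_hom A C :=
  GrAlgHom (alg_hom_comp (gralg_alg_hom f) (gralg_alg_hom g))
    (graded_comp (gralg_graded f) (gralg_graded g))
    (graded_injective_comp (@gralg_inj _ _ f) (gralg_graded g)
       (@gralg_inj _ _ g)).

Lemma gralg_compIl (A B : gralg) (f : gralg_hom A B) :
  gralg_comp (gralg_idmap B) f = f.
Proof. exact: gralg_hom_ext. Qed.

Lemma gralg_compIr (A B : gralg) (f : gralg_hom A B) :
  gralg_comp f (gralg_idmap A) = f.
Proof. exact: gralg_hom_ext. Qed.

Lemma gralg_compA (A B C D : gralg) (h : gralg_hom C D) (g : gralg_hom B C)
    (f : gralg_hom A B) :
  gralg_comp h (gralg_comp g f) = gralg_comp (gralg_comp h g) f.
Proof. exact: gralg_hom_ext. Qed.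

Definition GrAlg : category :=
  Category gralg_compIl gralg_compIr gralg_compA.

Record gralg1 := GrAlg1Obj {
  gralg1_sort :> unitalAlgType F;
  gralg1_group : groupType;
  gralg1_part : gralg1_group -> set gralg1_sort;
  gralg1_grading : is_grading gralg1_part
}.
Arguments gralg1_part : clear implicits.

Record gralg1_hom (A B : gralg1) := GrAlg1Hom {
  gralg1_fun :> A -> B;
  gralg1_alg_hom : alg_hom gralg1_fun;
  gralg1_unital : gralg1_fun 1%g = 1%g;
  gralg1_graded : graded (gralg1_part A) (gralg1_part B) gralg1_fun;
  gralg1_inj : graded_injective (gralg1_part A) gralg1_fun
}.

Lemma gralg1_hom_ext (A B : gralg1) (f g : gralg1_hom A B) :
  gralg1_fun f = gralg1_fun g -> f = g.
Proof.
case: f g => [f f1 f2 f3 f4] [g g1 g2 g3 g4] /= fg.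
case: g / fg g1 g2 g3 g4 => g1 g2 g3 g4.
by congr GrAlg1Hom; apply: Prop_irrelevance.
Qed.

Definition gralg1_idmap (A : gralg1) : gralg1_hom A A :=
  GrAlg1Hom (alg_hom_id A) erefl (@graded_id _ _ _)
    (@graded_injective_id _ _ _).

Lemma gralg1_comp_unital (A B C : gralg1) (f : gralg1_hom B C)
  (g : gralg1_hom A B) : (f \o g) 1%g = 1%g.
Proof. by rewrite /= !gralg1_unital. Qed.

Definition gralg1_comp (A B C : gralg1) (f : gralg1_hom B C)
    (g : gralg1_hom A B) : gralg1_hom A C :=
  GrAlg1Hom (alg_hom_comp (gralg1_alg_hom f) (gralg1_alg_hom g))
    (gralg1_comp_unital f g)
    (graded_comp (gralg1_graded f) (gralg1_graded g))
    (graded_injective_comp (@gralg1_inj _ _ f) (gralg1_graded g)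
       (@gralg1_inj _ _ g)).

Lemma gralg1_compIl (A B : gralg1) (f : gralg1_hom A B) :
  gralg1_comp (gralg1_idmap B) f = f.
Proof. exact: gralg1_hom_ext. Qed.

Lemma gralg1_compIr (A B : gralg1) (f : gralg1_hom A B) :
  gralg1_comp f (gralg1_idmap A) = f.
Proof. exact: gralg1_hom_ext. Qed.

Lemma gralg1_compA (A B C D : gralg1) (h : gralg1_hom C D) (g : gralg1_hom B C)
    (f : gralg1_hom A B) :
  gralg1_comp h (gralg1_comp g f) = gralg1_comp (gralg1_comp h g) f.
Proof. exact: gralg1_hom_ext. Qed.

Definition GrAlg1 : category :=
  Category gralg1_compIl gralg1_compIr gralg1_compA.

End Gradings.

Arguments gralg_part {F} A g : rename.
Arguments gralg1_part {F} A g : rename.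

(* Main.v *)
Require Import Defs.
From HB Require Import structures.
From mathcomp Require Import all_boot all_order all_algebra.
From mathcomp Require Import boolp classical_sets.

(** A homogeneous element of a graded algebra is the value at the generator of
    a graded homomorphism from a monogenic algebra, so elements are seen by
    morphisms, as in the proof that monomorphisms of algebras are injective.

    Injectivity on homogeneous elements gives a monomorphism: graded
    homomorphisms [u], [v] into [A] with [f \o u = f \o v] send homogeneous
    elements to homogeneous elements, so they agree on those, which span.

    Conversely, let [a <> b] be homogeneous with [f a = f b].  Because a
    morphism must be injective on every homogeneous component, the polynomial
    algebra in one variable is not a suitable source when [a] is nilpotent:
    the map sending [x^n] to [a^n] would kill some component.  The source has
    to be the algebra spanned by the [x^n] with [a^n != 0], where a product is
    zero when its exponent falls out of the list: it is [F[x]] or [F[x]/(x^N)],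
    without its constants in the nonunital case.  It is graded by the integers
    with one-dimensional components, and [x^n |-> a^n] is then a morphism.  The
    same source serves [b]: since [f (a^n) = f (b^n)] and [f] has no nonzero
    homogeneous element in its kernel, [a^n = 0] exactly when [b^n = 0].  The
    two morphisms are equalized by [f] but differ at [x], so [f] is not a
    monomorphism ([gralg_mono_injective], [gralg1_mono_injective]).

    In the unital case [x^0] goes to [1], which has to be homogeneous: in any
    group grading [1] has trivial degree ([grading_one]). *)

Set Implicit Arguments.
Unset Strict Implicit.
Unset Printing Implicit Defensive.

Import GRing.Theory.
Local Open Scope ring_scope.
Local Open Scope classical_set_scope.

(** * Consequences of bilinearity and of the grading axioms *)

Lemma linear_map0 (F : fieldType) (U V : lmodType F) (f : U -> V) :
  linear f -> f 0 = 0.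
Proof.
by move=> fl; have := fl (-1) 0 0; rewrite scaler0 addr0 scaleN1r addNr.
Qed.

Section AlgebraTheory.
Variables (F : fieldType) (A : assocAlgType F).
Implicit Types x y : A.

Lemma amul0l x : (0 * x)%g = 0 :> A.
Proof. by have := amulZl 0 (0 : A) x; rewrite !scale0r. Qed.

Lemma amul0r x : (x * 0)%g = 0 :> A.
Proof. by have := amulZr 0 x (0 : A); rewrite !scale0r. Qed.

Lemma amul_suml I (r : seq I) (E : I -> A) x :
  ((\sum_(i <- r) E i) * x)%g = \sum_(i <- r) (E i * x)%g.
Proof.
exact: (big_morph (fun z : A => (z * x)%g)
  (fun z t => amulDl z t x) (amul0l x)).
Qed.

Lemma amul_sumr I (r : seq I) (E : I -> A) x :
  (x * (\sum_(i <- r) E i))%g = \sum_(i <- r) (x * E i)%g.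
Proof. exact: (big_morph (fun z : A => (x * z)%g) (amulDr x) (amul0r x)). Qed.

End AlgebraTheory.

Section GradingTheory.
Variables (F : fieldType) (A : assocAlgType F) (G : groupType).
Variables (C : G -> set A) (gradC : is_grading C).

Lemma grading_scale g (c : F) x : C g x -> C g (c *: x).
Proof.
by move=> Cx; rewrite -[c *: x]addr0; apply: (gradingP gradC) => //;
  exact: grading0 gradC g.
Qed.

Lemma grading_sub g x y : C g x -> C g y -> C g (x - y).
Proof.
move=> Cx Cy; rewrite addrC -scaleN1r.
exact: gradingP gradC _ _ _ _ Cy Cx.
Qed.

Lemma homogeneous0 : homogeneous C 0.
Proof. by exists 1%g => //; exact: grading0 gradC 1%g. Qed.

Lemma homogeneous_mul x y :
  homogeneous C x -> homogeneous C y -> homogeneous C (x * y)%g.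
Proof.
by move=> [g _ Cx] [h _ Cy]; exists (g * h)%g => //; apply: (grading_mul gradC).
Qed.

(** Injectivity on each component forbids a nonzero homogeneous element in the
    kernel, even though [x] and [y] may have different degrees. *)
Lemma homogeneous_eq0 (B : assocAlgType F) (f : A -> B) x y :
  linear f -> graded_injective C f ->
  homogeneous C x -> homogeneous C y -> f x = f y -> (x == 0) = (y == 0).
Proof.
move=> fl finj.
have ker z : homogeneous C z -> f z = 0 -> z = 0.
  move=> [g _ Cz] fz0; apply: (finj g) => //; last by rewrite linear_map0.
  exact: grading0 gradC g.
move=> Cx Cy fxy; apply/eqP/eqP => z0; apply: ker => //.
  by rewrite -fxy z0 linear_map0.
by rewrite fxy z0 linear_map0.
Qed.

Lemma homogeneous_collision_neq0 (B : assocAlgType F) (f : A -> B) x y :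
  linear f -> graded_injective C f ->
  homogeneous C x -> homogeneous C y -> f x = f y -> x <> y -> x != 0.
Proof.
move=> fl finj Cx Cy fxy xy; apply: contra_notN xy => x0.
by move: (x0); rewrite (homogeneous_eq0 fl finj Cx Cy fxy) (eqP x0) => /eqP.
Qed.

Lemma linear_ext_homogeneous (B : lmodType F) (u v : A -> B) :
  linear u -> linear v ->
  (forall x, homogeneous C x -> u x = v x) -> u =1 v.
Proof.
move=> ul vl uv x.
pose U : {linear A -> B} := HB.pack u (GRing.isLinear.Build F A B _ u ul).
pose V : {linear A -> B} := HB.pack v (GRing.isLinear.Build F A B _ v vl).
have [s [w [_ Cw ->]]] := grading_span gradC x.
rewrite -[u _]/(U _) -[v _]/(V _) !linear_sum; apply: eq_bigr => g _.
by apply: uv; exists g.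
Qed.

End GradingTheory.

(** The component [u 1] of [1] in trivial degree is already a left identity:
    for [x] of degree [h], the term of degree [h] in [1 * x] is [u 1 * x].
    Hence [u 1 = u 1 * 1 = 1]. *)
Lemma grading_one (F : fieldType) (A : unitalAlgType F) (G : groupType)
  (C : G -> set A) : is_grading C -> C 1%g 1%g.
Proof.
move=> gradC.
have [s0 [u0 [us0 Cu0 one_def0]]] := grading_span gradC (1%g : A).
have [s [u [us s1 Cu one_def]]] : exists (s : seq G) (u : G -> A),
  [/\ uniq s, 1%g \in s, forall g, C g (u g) & 1%g = \sum_(g <- s) u g].
  have [s01|s01] := boolP (1%g \in s0); first by exists s0, u0.
  exists (1%g :: s0), (fun g => if g \in s0 then u0 g else 0); split.
  - by rewrite /= s01.
  - by rewrite mem_head.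
  - by move=> g; case: ifP => // _; apply: grading0 gradC g.
  - rewrite big_cons (negPf s01) add0r one_def0.
    by apply: eq_big_seq => g ->.
have u1_unit x : homogeneous C x -> (u 1%g * x)%g = x.
  move=> [h _ Cx].
  (* [w k] is the component of degree [k] of [1 * x - x], which is zero. *)
  pose w k : A := (u (k * h^-1) * x)%g - (if k == h then x else 0).
  have Cw k : C k (w k).
    apply: (grading_sub gradC).
      by rewrite -[X in C X](mulgVK h k); apply: (grading_mul gradC).
    by case: eqP => [->//|_]; apply: grading0 gradC k.
  have hs : h \in [seq (g * h)%g | g <- s].
    by apply/mapP; exists 1%g; rewrite // mul1g.
  have ush : uniq [seq (g * h)%g | g <- s] by rewrite (map_inj_uniq (mulIg h)).
  have := grading_indep gradC ush Cw _ hs; rewrite /w eqxx mulgV => w0.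
  apply/eqP; rewrite -subr_eq0; apply/eqP/w0.
  rewrite big_map big_split /= sumrN.
  under eq_bigr => g _ do rewrite mulgK.
  under [X in _ - X]eq_bigr => g _ do rewrite -{2}(mul1g h) (inj_eq (mulIg h)).
  rewrite -amul_suml -one_def mul1g -big_mkcond /= -big_filter.
  by rewrite filter_pred1_uniq // big_seq1 subrr.
suff -> : 1%g = u 1%g by [].
apply/esym; rewrite -[u 1%g]mulg1.
apply: (linear_ext_homogeneous gradC
  (u := fun x => (u 1%g * x)%g) (v := id)) => //.
by move=> c x y; rewrite amulDr amulZr.
Qed.

(** * The algebra spanned by the powers of a variable in a set of exponents *)

(** The condition under which the truncated product of monomials is
    associative: if the total degree of a triple product survives, then so does
    the degree of the partial product. *)
Definition summable_exponents (S : pred nat) : Prop :=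
  forall i j k, S i -> S j -> S k -> S (i + j + k)%N -> S (i + j)%N.

Structure exponents := Exponents {
  in_exponents :> pred nat;
  exponentsP : summable_exponents in_exponents
}.

Section MonomialAlgebra.
Variables (F : fieldType) (S : exponents).

Definition supported (p : {poly F}) : bool :=
  [forall i : 'I_(size p), (p`_i != 0) ==> S i].

Lemma supportedP (p : {poly F}) :
  reflect (forall i, p`_i != 0 -> S i) (supported p).
Proof.
apply: (iffP forallP) => [Sp i pi|Sp i]; last by apply/implyP/Sp.
have ip : (i < size p)%N.
  by rewrite ltnNge; apply: contra pi => pi; rewrite nth_default.
exact: (implyP (Sp (Ordinal ip))).
Qed.

Lemma supported_nz (p : {poly F}) i : supported p -> ~~ S i -> p`_i = 0.
Proof. by move=> /supportedP Sp; apply: contraNeq => /Sp. Qed.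

Lemma supported_submod : subsemimod_closed supported.
Proof.
split; [split|].
- by apply/supportedP => i; rewrite coef0 eqxx.
- move=> p q Sp Sq; apply/supportedP => i; rewrite coefD.
  by apply: contraNT => nSi; rewrite !supported_nz // addr0.
- move=> c p Sp; apply/supportedP => i; rewrite coefZ.
  by apply: contraNT => nSi; rewrite supported_nz // mulr0.
Qed.

(** Instead of a quotient of an ideal of [{poly F}], the polynomials with
    support in [S] serve as normal forms; the product is then truncated. *)
Record monomial_alg := MonomialAlg {
  monomial_poly : {poly F};
  monomial_supported : supported monomial_poly
}.

HB.instance Definition _ := [isSub for monomial_poly].
HB.instance Definition _ := [Choice of monomial_alg by <:].
HB.instance Definition _ :=
  GRing.SubChoice_isSubLmodule.Build F {poly F} supported monomial_alg
    supported_submod.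

Lemma monomial_poly_linear : linear monomial_poly.
Proof. by []. Qed.

HB.instance Definition _ :=
  GRing.isLinear.Build F monomial_alg {poly F} _ monomial_poly
    monomial_poly_linear.

Definition restrict (p : {poly F}) : {poly F} :=
  \poly_(i < size p) (if S i then p`_i else 0).

Lemma coef_restrict p i : (restrict p)`_i = if S i then p`_i else 0.
Proof.
rewrite coef_poly; case: ltnP => // pi.
by rewrite nth_default // if_same.
Qed.

Lemma restrict_supported p : supported (restrict p).
Proof.
by apply/supportedP => i; rewrite coef_restrict; case: ifP; rewrite ?eqxx.
Qed.

Lemma restrict_id p : supported p -> restrict p = p.
Proof.
move=> Sp; apply/polyP => i; rewrite coef_restrict.
by case: ifPn => // /(supported_nz Sp).
Qed.

Lemma restrictD p q : restrict (p + q) = restrict p + restrict q.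
Proof.
apply/polyP => i; rewrite coefD !coef_restrict coefD.
by case: ifP; rewrite ?addr0.
Qed.

Lemma restrictZ c p : restrict (c *: p) = c *: restrict p.
Proof.
apply/polyP => i; rewrite coefZ !coef_restrict coefZ.
by case: ifP; rewrite ?mulr0.
Qed.

(** A coefficient of [p * q] in a degree [m] outside [S] contributes nothing to
    a degree [n] of [S] in [p * q * r]: otherwise [m] would be the sum of two
    exponents of [S] which, with a third one, add up to [n] in [S], and such a
    partial sum lies in [S]. *)
Lemma restrict_mul_restrict p q r : supported p -> supported q -> supported r ->
  restrict (restrict (p * q) * r) = restrict (p * q * r).
Proof.
move=> Sp Sq Sr; apply/polyP => n; rewrite !coef_restrict; case: ifP => // Sn.
rewrite !coefM; apply: eq_bigr => -[m /= mn] _.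
rewrite coef_restrict; case: ifPn => // nSm.
have [r0|rn] := eqVneq r`_(n - m) 0; first by rewrite r0 !mulr0.
rewrite coefM big1 ?mul0r // => -[i /= im] _.
have [->|pi] := eqVneq p`_i 0; first by rewrite mul0r.
have [->|qi] := eqVneq q`_(m - i) 0; first by rewrite mulr0.
have := exponentsP (supportedP _ Sp _ pi) (supportedP _ Sq _ qi)
  (supportedP _ Sr _ rn).
by rewrite !subnKC // => /(_ Sn) Sm; rewrite Sm in nSm.
Qed.

Definition monomial_mul (p q : monomial_alg) : monomial_alg :=
  MonomialAlg (restrict_supported (monomial_poly p * monomial_poly q)).

Lemma monomial_mulA : associative monomial_mul.
Proof.
move=> [p Sp] [q Sq] [r Sr]; apply: val_inj => /=.
rewrite restrict_mul_restrict // mulrC restrict_mul_restrict //.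
by rewrite mulrC mulrA.
Qed.

HB.instance Definition _ := isSemigroup.Build monomial_alg monomial_mulA.

Lemma monomial_mulDl (p q r : monomial_alg) :
  ((p + q) * r)%g = (p * r)%g + (q * r)%g :> monomial_alg.
Proof. by apply: val_inj; rewrite /= mulrDl restrictD. Qed.

Lemma monomial_mulDr (p q r : monomial_alg) :
  (p * (q + r))%g = (p * q)%g + (p * r)%g :> monomial_alg.
Proof. by apply: val_inj; rewrite /= mulrDr restrictD. Qed.

Lemma monomial_mulZl c (p q : monomial_alg) :
  ((c *: p) * q)%g = c *: (p * q)%g :> monomial_alg.
Proof. by apply: val_inj; rewrite /= -scalerAl restrictZ. Qed.

Lemma monomial_mulZr c (p q : monomial_alg) :
  (p * (c *: q))%g = c *: (p * q)%g :> monomial_alg.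
Proof. by apply: val_inj; rewrite /= -scalerAr restrictZ. Qed.

HB.instance Definition _ := isBilinearMul.Build F monomial_alg
  monomial_mulDl monomial_mulDr monomial_mulZl monomial_mulZr.

Lemma term_supported (c : F) n : S n -> supported (c *: 'X^n).
Proof.
move=> Sn; apply/supportedP => i; rewrite coefZ coefXn.
by case: (eqVneq i n) => [->//|_]; rewrite mulr0 eqxx.
Qed.

(** The group is the integers, written multiplicatively; negative degrees have
    zero component. *)
Definition monomial_part (k : Algebra.to_multiplicative int) :
    set monomial_alg :=
  [set p | forall i : nat, (monomial_poly p)`_i != 0 -> i%:Z = k].

Lemma monomial_partP k p : monomial_part k p ->
  p = 0 \/ exists (n : nat) (c : F),
    [/\ k = n%:Z, S n & monomial_poly p = c *: 'X^n].
Proof.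
move=> Cp; have [p0|/negP pn0] := pselect (monomial_poly p == 0).
  by left; apply: val_inj => /=; apply/eqP.
right; exists (size (monomial_poly p)).-1, (lead_coef (monomial_poly p)).
have ln0 : (monomial_poly p)`_(size (monomial_poly p)).-1 != 0.
  by rewrite -lead_coefE lead_coef_eq0.
split; first by rewrite (Cp _ ln0).
  exact: (supportedP _ (monomial_supported p)).
apply/polyP => i; rewrite coefZ coefXn.
case: eqP => [->|ni]; rewrite (mulr1, mulr0) //.
apply: contra_notP ni => /eqP pi.
by have := Cp _ ln0; rewrite -(Cp _ pi) => -[].
Qed.

Lemma monomial_grading : is_grading monomial_part.
Proof.
split.
- by move=> k i /=; rewrite coef0 eqxx.
- move=> k c p q Cp Cq i /=; rewrite coefD coefZ.
  have [pi|/Cp//] := eqVneq (monomial_poly p)`_i 0.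
  by rewrite pi mulr0 add0r; apply: Cq.
- move=> p; pose P := monomial_poly p.
  have Sterm n : supported (P`_n *: 'X^n).
    have [Pn|Pn] := eqVneq P`_n 0.
      by apply/supportedP => i; rewrite Pn scale0r coef0 eqxx.
    exact/term_supported/(supportedP _ (monomial_supported p)).
  exists (map Posz (iota 0 (size P))), (fun k => match k with
    | Posz n => MonomialAlg (Sterm n) | Negz _ => 0 end); split.
  + by rewrite map_inj_uniq ?iota_uniq // => i j [].
  + case=> n i /=; last by rewrite coef0 eqxx.
    rewrite coefZ coefXn; case: (eqVneq i n) => [->//|_].
    by rewrite mulr0 eqxx.
  + apply: val_inj; rewrite /= big_map raddf_sum /= -/P -[LHS]coefK poly_def.
    by rewrite -(big_mkord xpredT (fun i => P`_i *: 'X^i)) /index_iota subn0.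
- move=> s u us Cu u0 g gs; apply: val_inj; apply/polyP => i /=; rewrite coef0.
  have [//|ugi] := eqVneq (monomial_poly (u g))`_i 0.
  have := congr1 (fun p => (monomial_poly p)`_i) u0.
  rewrite raddf_sum coef_sum (bigD1_seq g) //= big1 ?addr0 ?coef0 // => k kg.
  apply: contraNeq kg => uki; apply/eqP.
  by rewrite -(Cu _ _ uki) (Cu _ _ ugi).
- move=> g h p q Cp Cq n /=; rewrite coef_restrict.
  case: ifP => [_|]; rewrite ?eqxx // coefM => /eqP pqn.
  apply: contrapT => ngh; apply: pqn; apply: big1 => -[i /= im] _.
  have [->|pi] := eqVneq (monomial_poly p)`_i 0; first by rewrite mul0r.
  have [->|qi] := eqVneq (monomial_poly q)`_(n - i) 0; first by rewrite mulr0.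
  case: ngh; rewrite -(Cp _ pi) -(Cq _ qi) -[RHS]PoszD.
  by rewrite subnKC.
Qed.

End MonomialAlgebra.

(** * Evaluation at a sequence of powers *)

Section Evaluation.
Variables (F : fieldType) (A : assocAlgType F) (P : nat -> A).

(** Horner evaluation does not apply, since [P] takes its values in an algebra
    that may have no unit; [P n] stands for the [n]th power of an element. *)
Definition eval_poly (p : {poly F}) : A := \sum_(i < size p) p`_i *: P i.

Lemma eval_poly_wide n (p : {poly F}) : (size p <= n)%N ->
  eval_poly p = \sum_(i < n) p`_i *: P i.
Proof.
move=> pn; rewrite /eval_poly (big_ord_widen n (fun i => p`_i *: P i) pn).
rewrite big_mkcond; apply: eq_bigr => i _; case: ltnP => // pi.
by rewrite nth_default // scale0r.
Qed.

Lemma eval_poly_linear : linear eval_poly.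
Proof.
move=> c p q; pose n := maxn (size (c *: p + q)) (maxn (size p) (size q)).
rewrite !(@eval_poly_wide n) /n ?leq_max ?leqnn ?orbT //.
rewrite scaler_sumr -big_split; apply: eq_bigr => i _ /=.
by rewrite coefD coefZ scalerDl scalerA.
Qed.

HB.instance Definition _ :=
  GRing.isLinear.Build F {poly F} A _ eval_poly eval_poly_linear.

Lemma eval_polyXn n : eval_poly 'X^n = P n.
Proof.
rewrite /eval_poly size_polyXn big_ord_recr /= coefXn eqxx scale1r.
rewrite big1 ?add0r //.
by move=> i _; rewrite coefXn (ltn_eqF (ltn_ord i)) scale0r.
Qed.

Lemma linear_eval_poly (B : lmodType F) (f : A -> B) p : linear f ->
  f (eval_poly p) = \sum_(i < size p) p`_i *: f (P i).
Proof.
move=> fl.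
pose g : {linear A -> B} := HB.pack f (GRing.isLinear.Build F A B _ f fl).
rewrite -[f _]/(g _) linear_sum; apply: eq_bigr => i _.
exact: (linearZZ g).
Qed.

Variable S : exponents.
(* [S] is exactly the support of [P]: [P] vanishes outside [S], so that
   truncating products does no harm, and nowhere on [S], so that evaluation is
   injective on the components. *)
Hypothesis SP : forall n, S n = (P n != 0).
Hypothesis PM : forall i j, S i -> S j -> (P i * P j)%g = P (i + j).

Definition monomial_eval (p : monomial_alg F S) : A :=
  eval_poly (monomial_poly p).

Lemma eval_restrict p : eval_poly (restrict S p) = eval_poly p.
Proof.
rewrite (@eval_poly_wide (size p)) ?size_poly //.
apply: eq_bigr => i _; rewrite coef_restrict SP.
by case: eqP => //= ->; rewrite !scaler0.
Qed.

Lemma monomial_eval_alg_hom : alg_hom monomial_eval.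
Proof.
split; first by move=> c p q; exact: eval_poly_linear.
move=> [p Sp] [q Sq]; rewrite /monomial_eval /= eval_restrict.
rewrite -{1}(coefK p) -{1}(coefK q) !poly_def mulr_suml linear_sum amul_suml.
apply: eq_bigr => i _; rewrite mulr_sumr linear_sum amul_sumr.
apply: eq_bigr => j _; rewrite -scalerAl -scalerAr -exprD !linearZ /=.
rewrite eval_polyXn amulZl amulZr.
have [->|pi] := eqVneq p`_i 0; first by rewrite !scale0r.
have [->|qj] := eqVneq q`_j 0; first by rewrite !scale0r.
rewrite PM ?scalerA //; first exact: supportedP Sp _ pi.
exact: supportedP Sq _ qj.
Qed.

Lemma monomial_eval_graded (G : groupType) (C : G -> set A) : is_grading C ->
  (forall n, homogeneous C (P n)) ->
  graded (@monomial_part F S) C monomial_eval.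
Proof.
move=> gradC Phom k.
(* A negative degree has only the element 0, which fits in any component. *)
have [n kn] : exists n : nat, forall m : nat, k = m%:Z -> n = m.
  by case: k => n; [exists n => m [] | exists 0%N].
have [g _ Cg] := Phom n; exists g => _ [p Cp <-].
have [->|[m [c [km _ pm]]]] := monomial_partP Cp.
  by rewrite /monomial_eval /= linear0; exact: grading0 gradC g.
rewrite /monomial_eval pm linearZ /= eval_polyXn -(kn m km).
exact: grading_scale.
Qed.

Lemma monomial_eval_graded_injective :
  graded_injective (@monomial_part F S) monomial_eval.
Proof.
have eval0 k p : monomial_part k p -> monomial_eval p = 0 -> p = 0.
  move=> Cp; have [//|[n [c [_ Sn pn]]]] := monomial_partP Cp.
  rewrite /monomial_eval pn linearZ /= eval_polyXn => /eqP.
  rewrite scaler_eq0 -[P n == 0]negbK -SP Sn orbF => /eqP c0.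
  by apply: val_inj; rewrite /= pn c0 scale0r.
move=> k p q Cp Cq pq; apply/eqP; rewrite -subr_eq0; apply/eqP.
apply: (eval0 k); first exact: (grading_sub (monomial_grading F S)).
by move: pq; rewrite /monomial_eval /= linearB /= => ->; rewrite subrr.
Qed.

End Evaluation.

(** * The unital case of the source algebra *)

(** A separate name for the carrier, so that the proof [S0] needed by the unit
    is found by canonical structure inference. *)
Definition monomial_alg1 (F : fieldType) (S : exponents) (S0 : S 0%N) : Type :=
  monomial_alg F S.

Section UnitalMonomialAlgebra.
Variables (F : fieldType) (S : exponents) (S0 : S 0%N).
Local Notation Z := (@monomial_alg1 F S S0).

HB.instance Definition _ := AssocAlgebra.copy Z (monomial_alg F S).

Lemma supported1 : supported S (1 : {poly F}).
Proof. by have := term_supported (1 : F) S0; rewrite scale1r. Qed.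

Definition monomial_one : Z := MonomialAlg supported1.

Lemma monomial_mul1 : left_id monomial_one (@monomial_mul F S).
Proof.
by move=> p; apply: val_inj; rewrite /= mul1r restrict_id ?monomial_supported.
Qed.

Lemma monomial_mulr1 : right_id monomial_one (@monomial_mul F S).
Proof.
by move=> p; apply: val_inj; rewrite /= mulr1 restrict_id ?monomial_supported.
Qed.

HB.instance Definition _ :=
  Semigroup_isMonoid.Build Z monomial_mul1 monomial_mulr1.

End UnitalMonomialAlgebra.

(** * Powers of a homogeneous element *)

(** Powers in an algebra without unit.  The value [0] at exponent [0] excludes
    [0] from the set of exponents with nonzero power, so that the source algebra
    has no constants. *)
Definition pos_pow (F : fieldType) (A : assocAlgType F) (a : A) (n : nat) : A :=
  if n is m.+1 then iter m ( *%g a) a else 0.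

Section PositivePowers.
Variables (F : fieldType) (A : assocAlgType F).

Lemma pos_powD (a : A) i j : (0 < i)%N -> (0 < j)%N ->
  (pos_pow a i * pos_pow a j)%g = pos_pow a (i + j).
Proof.
case: i => // i _; case: j => // j _; rewrite addSn addnS /=.
by elim: i => //= i <-; rewrite mulgA.
Qed.

Lemma pos_pow_neq0_gt0 (a : A) n : pos_pow a n != 0 -> (0 < n)%N.
Proof. by case: n => //=; rewrite eqxx. Qed.

Lemma pos_pow_summable (a : A) :
  summable_exponents (fun n => pos_pow a n != 0).
Proof.
move=> i j k /pos_pow_neq0_gt0 i0 /pos_pow_neq0_gt0 j0 /pos_pow_neq0_gt0 k0.
by apply: contraNneq => ij0; rewrite -pos_powD ?addn_gt0 ?i0 // ij0 amul0l.
Qed.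

Lemma morph_pos_pow (B : assocAlgType F) (f : A -> B) (a : A) n :
  alg_hom f -> f (pos_pow a n) = pos_pow (f a) n.
Proof.
move=> [fl fm]; case: n => [|n] /=.
  exact: linear_map0.
by elim: n => //= n <-; rewrite fm.
Qed.

Lemma homogeneous_pos_pow (G : groupType) (C : G -> set A) (a : A) n :
  is_grading C -> homogeneous C a -> homogeneous C (pos_pow a n).
Proof.
move=> gradC Ca; case: n => [|n] /=; first exact: homogeneous0.
by elim: n => //= n; apply: homogeneous_mul.
Qed.

End PositivePowers.

Section UnitalPowers.
Variables (F : fieldType) (A : unitalAlgType F).

Lemma pow_summable (a : A) : summable_exponents (fun n => (a ^+ n)%g != 0).
Proof.
move=> i j k _ _ _.
by apply: contraNneq => ij0; rewrite expgnDr ij0 amul0l.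
Qed.

Lemma morph_pow (B : unitalAlgType F) (f : A -> B) (a : A) n :
  alg_hom f -> f 1%g = 1%g -> f (a ^+ n)%g = (f a ^+ n)%g.
Proof. by move=> [_ fm] f1; elim: n => // n; rewrite !expgS fm => ->. Qed.

Lemma homogeneous_pow (G : groupType) (C : G -> set A) (a : A) n :
  is_grading C -> homogeneous C a -> homogeneous C (a ^+ n)%g.
Proof.
move=> gradC Ca; elim: n => [|n]; last by rewrite expgS; apply: homogeneous_mul.
by rewrite expg0; exists 1%g => //; exact: grading_one.
Qed.

End UnitalPowers.

(** * Monomorphisms and injectivity on homogeneous elements *)

(** The morphisms sending the variable to [a] and to [b] are equalized by [f],
    hence equal, hence have the same value at the variable. *)
Lemma gralg_mono_injective (F : fieldType) (A B : gralg F) (f : gralg_hom A B)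
  (a b : A) : monomorphism (GrAlg F) f -> homogeneous (gralg_part A) a ->
  homogeneous (gralg_part A) b -> f a = f b -> a = b.
Proof.
move=> fmono ha hb fab; apply: contrapT => ab.
have fpow n : f (pos_pow a n) = f (pos_pow b n).
  by rewrite !morph_pos_pow ?fab //; apply: gralg_alg_hom.
have hpow (c : A) n : homogeneous (gralg_part A) c ->
    homogeneous (gralg_part A) (pos_pow c n).
  exact/homogeneous_pos_pow/gralg_grading.
pose S := Exponents (@pos_pow_summable F A a).
have Sa n : S n = (pos_pow a n != 0) by [].
have Sb n : S n = (pos_pow b n != 0).
  congr (~~ _); apply: (homogeneous_eq0 (gralg_grading A) (f := f)) (fpow n).
  - exact: (gralg_alg_hom f).1.
  - exact: gralg_inj.
  - exact: hpow.
  - exact: hpow.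
have powM (c : A) : (forall n, S n = (pos_pow c n != 0)) ->
    forall i j, S i -> S j ->
    (pos_pow c i * pos_pow c j)%g = pos_pow c (i + j).
  by move=> Sc i j; rewrite !Sc => /pos_pow_neq0_gt0 i0 /pos_pow_neq0_gt0 j0;
    exact: pos_powD.
pose Z : gralg F := GrAlgObj (monomial_grading F S).
pose ev (c : A) (hc : homogeneous (gralg_part A) c)
    (Sc : forall n, S n = (pos_pow c n != 0)) : gralg_hom Z A :=
  @GrAlgHom F Z A _ (monomial_eval_alg_hom Sc (powM c Sc))
    (monomial_eval_graded S (gralg_grading A) (fun n => hpow c n hc))
    (monomial_eval_graded_injective Sc).
have ev_eq : ev a ha Sa = ev b hb Sb.
  apply: fmono; apply: gralg_hom_ext; apply/funext => p /=.
  rewrite /monomial_eval !(linear_eval_poly _ _ (gralg_alg_hom f).1).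
  by under eq_bigr do rewrite fpow.
have S1 : S 1%N.
  rewrite Sa /=; exact: (homogeneous_collision_neq0 (gralg_grading A)
    (gralg_alg_hom f).1 (@gralg_inj _ _ _ f) ha hb fab ab).
have := congr1 (fun u : gralg_hom Z A =>
  u (MonomialAlg (term_supported 1 S1))) ev_eq.
by rewrite /= /monomial_eval /= scale1r !eval_polyXn.
Qed.

(** The same argument with constants allowed; the exponent [0] is present
    because [1 = 0] would force [a = 0]. *)
Lemma gralg1_mono_injective (F : fieldType) (A B : gralg1 F)
  (f : gralg1_hom A B) (a b : A) : monomorphism (GrAlg1 F) f ->
  homogeneous (gralg1_part A) a -> homogeneous (gralg1_part A) b ->
  f a = f b -> a = b.
Proof.
move=> fmono ha hb fab; apply: contrapT => ab.
have fpow n : f (a ^+ n)%g = f (b ^+ n)%g.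
  rewrite !(morph_pow _ _ (gralg1_alg_hom f) (gralg1_unital f)).
  by rewrite fab.
have hpow (c : A) n : homogeneous (gralg1_part A) c ->
    homogeneous (gralg1_part A) (c ^+ n)%g.
  exact/homogeneous_pow/gralg1_grading.
pose S := Exponents (@pow_summable F A a).
have Sa n : S n = ((a ^+ n)%g != 0) by [].
have Sb n : S n = ((b ^+ n)%g != 0).
  congr (~~ _); apply: (homogeneous_eq0 (gralg1_grading A) (f := f)) (fpow n).
  - exact: (gralg1_alg_hom f).1.
  - exact: gralg1_inj.
  - exact: hpow.
  - exact: hpow.
have powM (c : A) i j : S i -> S j -> (c ^+ i * c ^+ j)%g = (c ^+ (i + j))%g.
  by rewrite expgnDr.
have S1 : S 1%N.
  rewrite Sa expg1; exact: (homogeneous_collision_neq0 (gralg1_grading A)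
    (gralg1_alg_hom f).1 (@gralg1_inj _ _ _ f) ha hb fab ab).
have S0 : S 0%N.
  rewrite Sa expg0; apply: contraNneq S1 => one0.
  by rewrite -[a]mul1g one0 amul0l.
pose Z : gralg1 F :=
  @GrAlg1Obj F (@monomial_alg1 F S S0) _ _ (monomial_grading F S).
have ev_unital (c : A) :
    @monomial_eval F A (fun n => c ^+ n)%g S (1%g : Z) = 1%g.
  by rewrite /monomial_eval /= -(expr0 'X) eval_polyXn.
pose ev (c : A) (hc : homogeneous (gralg1_part A) c)
    (Sc : forall n, S n = ((c ^+ n)%g != 0)) : gralg1_hom Z A :=
  @GrAlg1Hom F Z A _ (monomial_eval_alg_hom Sc (powM c)) (ev_unital c)
    (monomial_eval_graded S (gralg1_grading A) (fun n => hpow c n hc))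
    (monomial_eval_graded_injective Sc).
have ev_eq : ev a ha Sa = ev b hb Sb.
  apply: fmono; apply: gralg1_hom_ext; apply/funext => p /=.
  rewrite /monomial_eval !(linear_eval_poly _ _ (gralg1_alg_hom f).1).
  by under eq_bigr do rewrite fpow.
have := congr1 (fun u : gralg1_hom Z A =>
  u (MonomialAlg (term_supported 1 S1) : Z)) ev_eq.
by rewrite /= /monomial_eval /= scale1r !eval_polyXn.
Qed.

(** Two graded linear maps that agree on homogeneous elements agree on their
    span, and morphisms preserve homogeneity. *)
Lemma injective_gralg_mono (F : fieldType) (A B : gralg F)
  (f : gralg_hom A B) :
  (forall a b : A, homogeneous (gralg_part A) a ->
     homogeneous (gralg_part A) b -> f a = f b -> a = b) ->
  monomorphism (GrAlg F) f.
Proof.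
move=> finj Z u v fuv; apply: gralg_hom_ext; apply/funext.
apply: (linear_ext_homogeneous (gralg_grading Z)).
- exact: (gralg_alg_hom u).1.
- exact: (gralg_alg_hom v).1.
move=> z [g _ Cz]; apply: finj.
- by have [h uh] := gralg_graded u g; exists h => //; apply: uh; exists z.
- by have [h vh] := gralg_graded v g; exists h => //; apply: vh; exists z.
exact: (congr1 (fun w : gralg_hom Z B => w z) fuv).
Qed.

Lemma injective_gralg1_mono (F : fieldType) (A B : gralg1 F)
  (f : gralg1_hom A B) :
  (forall a b : A, homogeneous (gralg1_part A) a ->
     homogeneous (gralg1_part A) b -> f a = f b -> a = b) ->
  monomorphism (GrAlg1 F) f.
Proof.
move=> finj Z u v fuv; apply: gralg1_hom_ext; apply/funext.
apply: (linear_ext_homogeneous (gralg1_grading Z)).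
- exact: (gralg1_alg_hom u).1.
- exact: (gralg1_alg_hom v).1.
move=> z [g _ Cz]; apply: finj.
- by have [h uh] := gralg1_graded u g; exists h => //; apply: uh; exists z.
- by have [h vh] := gralg1_graded v g; exists h => //; apply: vh; exists z.
exact: (congr1 (fun w : gralg1_hom Z B => w z) fuv).
Qed.

Theorem proposition6p7 (F : fieldType) :
  (forall (A B : gralg F) (f : gralg_hom A B),
     monomorphism (GrAlg F) f <->
     (forall a b : A, homogeneous (gralg_part A) a ->
        homogeneous (gralg_part A) b -> a <> b -> f a <> f b)) /\
  (forall (A B : gralg1 F) (f : gralg1_hom A B),
     monomorphism (GrAlg1 F) f <->
     (forall a b : A, homogeneous (gralg1_part A) a ->
        homogeneous (gralg1_part A) b -> a <> b -> f a <> f b)).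
Proof.
split=> A B f; split.
- by move=> fmono a b ha hb ab /(gralg_mono_injective fmono ha hb).
- move=> finj; apply: injective_gralg_mono => a b ha hb fab.
  by apply: contrapT => /(finj a b ha hb).
- by move=> fmono a b ha hb ab /(gralg1_mono_injective fmono ha hb).
- move=> finj; apply: injective_gralg1_mono => a b ha hb fab.
  by apply: contrapT => /(finj a b ha hb).
Qed.
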